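(* For any integral domain $R$ and any subset $S \subseteq R$, the ring $\mathrm{Int}(S,R)$ is not a Cohen-Kaplansky domain (CKD).
   Context: For an integral domain $R$ with quotient field $K$ and a subset $S$ of $R$ (possibly empty), $\mathrm{Int}(S,R) := \{p(x) \in K[x] \mid p(S) \subseteq R\}$ is the ring of integer-valued polynomials of $R$ on $S$, a subring of $K[x]$ (so $\mathrm{Int}(\emptyset,R) = K[x]$). An integral domain is atomic if every nonzero nonunit is a finite product of irreducibles. A Cohen-Kaplansky domain (CKD) is an atomic domain containing only finitely many irreducibles up to associates. *)

(* Defs.v *)
From HB Require Import structures.
From mathcomp Require Import all_boot all_algebra.
From mathcomp Require Import boolp classical_sets.

Set Implicit Arguments.
Unset Strict Implicit.
Unset Printing Implicit Defensive.

Import GRing.Theory.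
Local Open Scope ring_scope.

Section Factorization.
Variable D : idomainType.

Definition irreducible_elt (a : D) : Prop :=
  [/\ a != 0, a \isn't a GRing.unit &
      forall b c : D, a = b * c -> b \is a GRing.unit \/ c \is a GRing.unit].

Definition associates (a b : D) : Prop :=
  exists2 u : D, u \is a GRing.unit & b = u * a.

Definition atomic : Prop :=
  forall a : D, a != 0 -> a \isn't a GRing.unit ->
  exists2 s : seq D, {in s, forall x, irreducible_elt x} & a = \prod_(x <- s) x.

(* [s] lists representatives of all associate classes of irreducibles. *)
Definition CKD : Prop :=
  atomic /\
  exists2 s : seq D, {in s, forall x, irreducible_elt x} &
    forall a : D, irreducible_elt a -> exists2 b, b \in s & associates a b.

End Factorization.

Section IntegerValued.
Variables (R : idomainType) (S : set R).
Local Open Scope classical_set_scope.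

Definition int_valued : {pred {poly {fraction R}}} :=
  [pred p | `[< (fun s : R => p.[tofrac s]) @` S `<=` range (@tofrac R) >]].

Lemma int_valuedP (p : {poly {fraction R}}) :
  reflect (forall s, S s -> exists r : R, p.[tofrac s] = tofrac r)
          (p \in int_valued).
Proof.
apply: (iffP (asboolP _)) => [pS s Ss | pS _ [s Ss <-]].
  by have [|r _ <-] := pS p.[tofrac s]; [exists s | exists r].
by have [r ->] := pS s Ss; exists r.
Qed.

Lemma int_valued_subring : subring_closed int_valued.
Proof.
split=> [|p q /int_valuedP pS /int_valuedP qS|p q /int_valuedP pS /int_valuedP qS];
  apply/int_valuedP => s Ss.
- by exists 1; rewrite hornerC rmorph1.
- have [a pa] := pS s Ss; have [b qb] := qS s Ss.
  by exists (a - b); rewrite hornerD hornerN pa qb rmorphB.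
- have [a pa] := pS s Ss; have [b qb] := qS s Ss.
  by exists (a * b); rewrite hornerM pa qb rmorphM.
Qed.

HB.instance Definition _ :=
  GRing.isSubringClosed.Build {poly {fraction R}} int_valued int_valued_subring.

Record Int := IntPoly { Int_val :> {poly {fraction R}};
                        Int_valP : Int_val \in int_valued }.

HB.instance Definition _ := [isSub for Int_val].
HB.instance Definition _ := [Choice of Int by <:].
HB.instance Definition _ := [SubChoice_isSubComNzRing of Int by <:].

(* Invertibility is meant in [Int], not in {poly {fraction R}}: a nonzero
   constant of R need not be a unit here. *)
Definition Int_unit : {pred Int} := [pred u | `[< exists v : Int, v * u = 1 >]].

Definition Int_inv (u : Int) : Int :=
  if pselect (exists v : Int, v * u = 1) is left e then projT1 (cid e) else u.

Lemma Int_mulVr : {in Int_unit, left_inverse 1 Int_inv *%R}.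
Proof.
move=> u /asboolP uP; rewrite /Int_inv; case: pselect => // e.
exact: (projT2 (cid e)).
Qed.

Lemma Int_unitP (u v : Int) : v * u = 1 -> Int_unit u.
Proof. by move=> vu; apply/asboolP; exists v. Qed.

Lemma Int_inv_out : {in [predC Int_unit], Int_inv =1 id}.
Proof.
move=> u /asboolPn uP; rewrite /Int_inv; case: pselect => // e.
Qed.

HB.instance Definition _ :=
  GRing.ComNzRing_hasMulInverse.Build Int Int_mulVr Int_unitP Int_inv_out.

Lemma Int_integral (p q : Int) : p * q = 0 -> (p == 0) || (q == 0).
Proof.
move=> /(congr1 val); rewrite rmorphM rmorph0 => /eqP.
by rewrite mulf_eq0 -!(inj_eq val_inj) rmorph0.
Qed.

HB.instance Definition _ :=
  GRing.ComUnitRing_isIntegral.Build Int Int_integral.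

End IntegerValued.

(* Main.v *)
Require Import Defs.
From mathcomp Require Import all_boot all_algebra.
From mathcomp Require Import boolp classical_sets.

(** The argument is Euclid's proof of the infinitude of primes.  In a CKD, let
    [P] be the product of representatives of the finitely many classes of
    irreducibles.  Every irreducible divides [P], hence none divides
    [1 + P * f], so by atomicity this element is zero or a unit, whatever [f]
    is ([CKD_euclid]).  The ring
    [Int S] contains the indeterminate, and [1 + P * 'X] has positive degree:
    it is neither zero nor a unit, since the units of [Int S] are units of the
    polynomial ring over the quotient field, hence constants. *)

Import GRing.Theory.
Local Open Scope ring_scope.

Lemma prod_irreducible_neq0 (D : idomainType) (s : seq D) :
  {in s, forall x, irreducible_elt x} -> \prod_(x <- s) x != 0.
Proof. by move=> s_irr; rewrite prodf_seq_neq0; apply/allP => x /s_irr[]. Qed.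

(** In ideal-theoretic terms: a CKD that is not a field has a nonzero Jacobson
    radical.  Allowing [1 + P * f] to vanish covers fields, where [P] is the
    empty product. *)
Lemma CKD_euclid (D : idomainType) : CKD D ->
  exists2 P : D, P != 0 &
    forall f : D, 1 + P * f != 0 -> 1 + P * f \is a GRing.unit.
Proof.
move=> [atomD [s s_irr s_all]].
exists (\prod_(x <- s) x); first exact: prod_irreducible_neq0.
move=> f nz; apply: contrapT => /negP nu.
have [[|a t] t_irr def_t] := atomD _ nz nu.
  by move: nu; rewrite def_t big_nil unitr1.
have a_irr : irreducible_elt a by apply: t_irr; rewrite mem_head.
have [_ a_nu _] := a_irr; have [b b_s [u u_unit def_b]] := s_all a a_irr.
move: def_t; rewrite big_cons (big_rem b b_s) /= def_b.
set p := \prod_(x <- _) x; set q := \prod_(x <- _) x => eq1.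
(* [a] divides both [1 + P * f] and [P], hence divides 1. *)
have a1 : a * (q - u * p * f) = 1.
  by rewrite mulrBr -eq1 !mulrA [a * u]mulrC addrK.
by move/negP: a_nu; apply; apply/unitrP; exists (q - u * p * f); rewrite mulrC.
Qed.

Lemma polyX_int_valued (R : idomainType) (S : set R) : 'X \in int_valued S.
Proof. by apply/int_valuedP => s _; exists s; rewrite hornerX. Qed.

Lemma Int_unit_size (R : idomainType) (S : set R) (u : Int S) :
  u \is a GRing.unit -> size (val u) = 1%N.
Proof.
move=> /(rmorph_unit (val : {rmorphism Int S -> {poly {fraction R}}})).
by rewrite poly_unitE => /andP[/eqP].
Qed.

Theorem proposition4p11 (R : idomainType) (S : set R) : ~ CKD (Int S).
Proof.
move=> /CKD_euclid[P Pn0 P_jac].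
pose x : Int S := IntPoly (polyX_int_valued R S).
have vP0 : val P != 0
  by rewrite -[0](rmorph0 (val : {rmorphism Int S -> {poly {fraction R}}}))
    (inj_eq val_inj).
have size_gt1 : (1 < size (val (1 + P * x)%R))%N.
  rewrite rmorphD rmorphM rmorph1 /= addrC size_polyDl size_mulX //.
    by rewrite ltnS size_poly_gt0.
  by rewrite size_poly1 ltnS size_poly_gt0.
have nz : 1 + P * x != 0.
  by apply: contraTneq size_gt1 => ->; rewrite rmorph0 size_poly0.
by move: size_gt1; rewrite (Int_unit_size _ _ _ (P_jac x nz)).
Qed.
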